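(* Let $G=(V,E,w)$ be a finite connected graph with $|V|=n\ge2$ and weights $w:E\to\mathbb{R}_{>0}$. Let $H$ be an arbitrary rooted binary hierarchy on $V$. There exists a rooted binary hierarchy $T$ on $V$, all of whose clusters induce connected subgraphs of $G$, such that for every edge $xy\in E$, $$|C_T(x,y)|\le|C_H(x,y)|.$$ Consequently, $$\operatorname{cost}_D^-(T)\le\operatorname{cost}_D^-(H)\quad\text{and}\quad\operatorname{cost}_D(T)\le\operatorname{cost}_D(H).$$
   Context: A rooted binary hierarchy $T$ on $V$ is a rooted tree whose leaves are the vertices of $V$ and whose internal nodes have exactly two children; each node is identified with the set of leaves in its subtree (a cluster), and $C_T(x,y)$ is the cluster of the lowest common ancestor of $x,y$. The standard and shifted Dasgupta objectives are $\operatorname{cost}_D(T)=\sum_{xy\in E}w_{xy}|C_T(x,y)|$ and $\operatorname{cost}_D^-(T)=\sum_{xy\in E}w_{xy}(|C_T(x,y)|-1)$. *)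

(* Defs.v *)
From HB Require Import structures.
From mathcomp Require Import all_boot all_order all_algebra.

Set Implicit Arguments.
Unset Strict Implicit.
Unset Printing Implicit Defensive.

Import GRing.Theory Num.Theory.

Local Open Scope ring_scope.

(* The graph on V with edge set E; a simple graph has E made of 2-element
   sets, the edge xy being [set x; y]. *)
Definition adj (V : finType) (E : {set {set V}}) : rel V :=
  [rel x y | [set x; y] \in E].

(* C induces a connected subgraph: any two vertices of C are joined by a path
   of edges both of whose ends lie in C. *)
Definition induces_connected (V : finType) (E : {set {set V}}) (C : {set V}) :=
  {in C &, forall x y,
    connect [rel u v | [&& u \in C, v \in C & adj E u v]] x y}.

Definition graph_connected (V : finType) (E : {set {set V}}) :=
  forall x y : V, connect (adj E) x y.

Inductive btree (V : Type) : Type :=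
| Leaf of V
| Node of btree V & btree V.

Fixpoint leaves (V : Type) (t : btree V) : seq V :=
  match t with
  | Leaf x => [:: x]
  | Node l r => leaves l ++ leaves r
  end.

Record hierarchy (V : finType) := Hierarchy {
  htree :> btree V;
  (* every vertex labels exactly one leaf *)
  _ : perm_eq (leaves htree) (enum V)
}.

Definition cluster (V : finType) (t : btree V) : {set V} :=
  [set x in leaves t].

Fixpoint clusters (V : finType) (t : btree V) : seq {set V} :=
  match t with
  | Leaf _ => [:: cluster t]
  | Node l r => cluster t :: clusters l ++ clusters r
  end.

(* The subtree rooted at the lowest common ancestor of the leaves in A: descend
   from the root as long as a child is an ancestor of all of A.  Only
   meaningful when A is nonempty, contained in [cluster t], and the leaves of
   t are distinct. *)
Fixpoint lca (V : finType) (t : btree V) (A : {set V}) : btree V :=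
  match t with
  | Leaf _ => t
  | Node l r =>
      if A \subset cluster l then lca l A
      else if A \subset cluster r then lca r A
      else t
  end.

(* C_T(x, y) is [lca_cluster T [set x; y]]; taking the set of leaves as
   argument lets the costs be sums over unordered edges. *)
Definition lca_cluster (V : finType) (T : hierarchy V) (A : {set V}) : {set V} :=
  cluster (lca T A).

(* Only the values of w on E matter. *)
Definition cost_D (R : realFieldType) (V : finType) (E : {set {set V}})
    (w : {set V} -> R) (T : hierarchy V) : R :=
  \sum_(A in E) w A * #|lca_cluster T A|%:R.

Definition cost_D_minus (R : realFieldType) (V : finType) (E : {set {set V}})
    (w : {set V} -> R) (T : hierarchy V) : R :=
  \sum_(A in E) w A * (#|lca_cluster T A|%:R - 1).

(* Main.v *)
Require Import Defs.
From HB Require Import structures.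
From mathcomp Require Import all_boot all_order all_algebra.

Set Implicit Arguments.
Unset Strict Implicit.
Unset Printing Implicit Defensive.

Import GRing.Theory Num.Theory.

Local Open Scope ring_scope.

(* Going up H, maintain a forest whose trees span the connected components of
   G[C], C being the current cluster of H.  At a node of H, put together the
   forests of its two children and merge two trees as long as an edge of G[C]
   joins them.  Each merge creates a connected cluster included in C, and it is
   the lowest common ancestor only of edges whose lowest common ancestor in H
   is C, which gives the bound.  Since G is connected, a single tree remains at
   the root. *)

(** Equality of trees must be decidable for a forest, a sequence of trees, to support membership,
    [rem] and [perm_eq]. *)
Lemma btree_comparable (V : eqType) : comparable (btree V).
Proof.
by move=> s t; rewrite /decidable; decide equality; apply: eq_comparable.
Qed.

HB.instance Definition _ (V : eqType) :=
  hasDecEq.Build (btree V) (compareP (@btree_comparable V)).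

Section Forests.

Variables (V : finType) (E : {set {set V}}).

Implicit Types (t l r : btree V) (A C D : {set V}) (F : seq (btree V)).

Lemma cluster_Node l r : cluster (Node l r) = cluster l :|: cluster r.
Proof. by apply/setP=> x; rewrite !inE mem_cat. Qed.

Lemma mem_clusters_root t : cluster t \in clusters t.
Proof. by case: t => *; rewrite inE eqxx. Qed.

Lemma leaves_neq_nil t : leaves t != [::].
Proof. by elim: t => [//|l + r _] /=; case: (leaves l). Qed.

(** [lca] tries the left child first; as the leaves are distinct, a nonempty [A] inside the right
    cluster cannot lie in the left one. *)
Lemma lca_Node_r l r A :
    uniq (leaves (Node l r)) -> A != set0 -> A \subset cluster r ->
  lca (Node l r) A = lca r A.
Proof.
rewrite /= cat_uniq => /and3P[_ /hasPn dis _] /set0Pn[x Ax] sAr.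
rewrite sAr ifF //; apply/negP=> /subsetP/(_ x Ax).
by move/subsetP/(_ x Ax): sAr; rewrite !inE => /dis/negP.
Qed.

Lemma connect_inducedS C D x y : C \subset D ->
    connect [rel u v | [&& u \in C, v \in C & adj E u v]] x y ->
  connect [rel u v | [&& u \in D, v \in D & adj E u v]] x y.
Proof.
move=> /subsetP sCD; apply: connect_sub => u v /and3P[Cu Cv Euv].
by apply: connect1; rewrite /= !sCD.
Qed.

Lemma induces_connectedU C D x y :
    induces_connected E C -> induces_connected E D ->
    x \in C -> y \in D -> [set x; y] \in E ->
  induces_connected E (C :|: D).
Proof.
move=> cC cD Cx Dy Exy.
pose e := [rel u v | [&& u \in C :|: D, v \in C :|: D & adj E u v]].
have eC u v : u \in C -> v \in C -> connect e u v.
  by move=> Cu Cv; apply: connect_inducedS (cC u v Cu Cv); apply: subsetUl.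
have eD u v : u \in D -> v \in D -> connect e u v.
  by move=> Du Dv; apply: connect_inducedS (cD u v Du Dv); apply: subsetUr.
have exy : connect e x y by apply: connect1; rewrite /= !inE Cx Dy orbT.
have eyx : connect e y x.
  by apply: connect1; rewrite /= !inE Cx Dy orbT /adj /= setUC.
move=> u v; rewrite !inE => /orP[Cu|Du] /orP[Cv|Dv]; auto.
  exact: connect_trans (eC u x Cu Cx) (connect_trans exy (eD y v Dy Dv)).
exact: connect_trans (eD u y Du Dy) (connect_trans eyx (eC x v Cx Cv)).
Qed.

(** * Forests refining a tree *)

(** The invariant of the construction. The size bound concerns only edges inside a single tree of
    [F]; edges between two trees have no common ancestor yet. *)
Definition refines t F :=
  [/\ perm_eq (flatten (map (@leaves V) F)) (leaves t),
      {in F, forall f C, C \in clusters f -> induces_connected E C}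
    & {in F & E, forall f A, A \subset cluster f ->
        (#|cluster (lca f A)| <= #|cluster (lca t A)|)%N}].

(** For an edge [A]: exactly one endpoint is a leaf of [t]. *)
Definition cuts A t :=
  ~~ [disjoint A & cluster t] && ~~ (A \subset cluster t).

Lemma mem_refines t F x : refines t F ->
  x \in cluster t -> exists2 f, f \in F & x \in cluster f.
Proof.
move=> [pF _ _]; rewrite inE -(perm_mem pF) => /flattenP[_ /mapP[f Ff ->] fx].
by exists f; rewrite // inE.
Qed.

Lemma refines_sub t F f : refines t F -> f \in F -> cluster f \subset cluster t.
Proof.
move=> [pF _ _] Ff; apply/subsetP=> x; rewrite !inE -(perm_mem pF) => fx.
by apply/flattenP; exists (leaves f); rewrite ?map_f.
Qed.

Lemma refines_perm t F F' : perm_eq F F' -> refines t F -> refines t F'.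
Proof.
move=> pFF' [pF cF bF]; have mF := perm_mem pFF'; split.
- by apply: perm_trans pF; rewrite perm_sym; apply/perm_flatten/perm_map.
- by move=> f; rewrite -mF; apply: cF.
- by move=> f A; rewrite -mF; apply: bF.
Qed.

(** Merging creates no new cut edge, so a property of all cut edges survives merges. *)
Lemma cuts_Node A l r : cuts A (Node l r) -> cuts A l || cuts A r.
Proof.
rewrite /cuts cluster_Node -setI_eq0 setIUr setU_eq0 negb_and !setI_eq0.
move=> /andP[/orP[-> | ->] /negP sA] /=; apply/orP; [left | right].
  by apply/negP => sAl; apply: sA; apply: subset_trans sAl (subsetUl _ _).
by apply/negP => sAr; apply: sA; apply: subset_trans sAr (subsetUr _ _).
Qed.

(** * Merging trees along edges *)

Hypothesis hE : forall A, A \in E -> #|A| = 2%N.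

Lemma edge_neq0 A : A \in E -> A != set0.
Proof. by move=> /hE cA; rewrite -card_gt0 cA. Qed.

(** The new root is the [lca] only of edges contained in neither [f] nor [g]. Such an edge cuts one
    of them, so its [lca] in [t] is [t] itself, whose cluster contains the new one. *)
Lemma refines_merge t f g F x y :
    refines t [:: f, g & F] ->
    {in E & [:: f, g & F], forall A h,
      A \subset cluster t -> cuts A h -> lca t A = t} ->
    x \in cluster f -> y \in cluster g -> [set x; y] \in E ->
  refines t (Node f g :: F).
Proof.
move=> rF; have [pF cF bF] := rF => cutF fx gy Exy.
have Ff : f \in [:: f, g & F] by rewrite inE eqxx.
have Fg : g \in [:: f, g & F] by rewrite !inE eqxx orbT.
have FF h : h \in F -> h \in [:: f, g & F] by rewrite !inE => ->; rewrite !orbT.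
have sfg : cluster (Node f g) \subset cluster t.
  by rewrite cluster_Node subUset !(refines_sub rF).
split.
- by rewrite /= -catA.
- move=> h; rewrite inE => /predU1P[->|/FF/cF //] C.
  rewrite /= inE mem_cat => /predU1P[->|/orP[/(cF f Ff) //|/(cF g Fg) //]].
  rewrite cluster_Node; apply: induces_connectedU fx gy Exy.
    exact: cF (mem_clusters_root f).
  exact: cF (mem_clusters_root g).
- move=> h A; rewrite inE => /predU1P[->|/FF/bF //]; last exact.
  move=> EA sA; rewrite /=; case: ifP => sAf; first exact: bF.
  case: ifP => sAg; first exact: bF.
  suff -> : lca t A = t by apply: subset_leq_card.
  have /set0Pn[z Az] := edge_neq0 EA.
  have sAt := subset_trans sA sfg.
  have meets h' : z \in cluster h' -> ~~ [disjoint A & cluster h'].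
    by move=> h'z; apply/pred0Pn; exists z; rewrite /= Az.
  have: z \in cluster (Node f g) by apply: (subsetP sA).
  rewrite cluster_Node inE => /orP[/meets mf|/meets mg].
    by apply: (cutF _ f EA Ff sAt); rewrite // /cuts mf sAf.
  by apply: (cutF _ g EA Fg sAt); rewrite // /cuts mg sAg.
Qed.

(** Induction on the number of trees: as long as an edge inside [cluster t] cuts a tree, merging
    along it removes one tree. *)
Lemma refines_saturate t F :
    refines t F ->
    {in E & F, forall A f, A \subset cluster t -> cuts A f -> lca t A = t} ->
  exists2 F', refines t F'
    & {in E & F', forall A f, A \subset cluster t -> ~~ cuts A f}.
Proof.
have [n leFn] := ubnP (size F); elim: n => // n IHn in F leFn *.
move=> rF cutF.
have [/exists_inP[A EA /andP[sAt /hasP[f Ff cutAf]]]|no_cut] :=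
  boolP [exists A in E, (A \subset cluster t) && has (cuts A) F]; last first.
  exists F => // A f EA Ff sAt; apply: contra no_cut => cutAf.
  by apply/exists_inP; exists A; rewrite ?sAt //=; apply/hasP; exists f.
(* The endpoint [y] outside [f] lies in another tree [g], because the forest covers [cluster t]. *)
have /andP[/pred0Pn[x /andP[/= Ax fx]] /subsetPn[y Ay fy]] := cutAf.
have [g Fg gy] := mem_refines rF (subsetP sAt y Ay).
have pF1 := perm_to_rem Ff.
have F1g : g \in rem f F.
  move: Fg; rewrite (perm_mem pF1) inE => /predU1P[gf|//].
  by rewrite -gf gy in fy.
have pF : perm_eq F [:: f, g & rem g (rem f F)].
  by apply: perm_trans pF1 _; rewrite perm_cons; apply: perm_to_rem.
set F2 := rem g _ in pF.
have Exy : [set x; y] \in E.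
  have nxy : x != y by apply: contraNneq fy => <-.
  suff -> : [set x; y] = A by [].
  apply/eqP; rewrite eqEcard hE // cards2 nxy andbT.
  by apply/subsetP => z /set2P[] ->.
have cutF2 : {in E & [:: f, g & F2], forall A h,
    A \subset cluster t -> cuts A h -> lca t A = t}.
  by move=> B h EB; rewrite -(perm_mem pF); apply: cutF.
apply: (IHn (Node f g :: F2)).
- by move: leFn; rewrite (perm_size pF).
- exact: refines_merge (refines_perm pF rF) cutF2 fx gy Exy.
- move=> B h EB; rewrite inE => /predU1P[->|F2h] sBt.
    move=> /cuts_Node/orP[]; apply: cutF2; rewrite // !inE eqxx ?orbT //.
  by apply: cutF2; rewrite // !inE F2h !orbT.
Qed.

(** With no edge of [cluster t] cut, each tree spans a connected component of the induced subgraph.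
    The forest of a node comes from saturating the union of its children's forests. *)
Lemma component_forest t : uniq (leaves t) ->
  exists2 F, refines t F
    & {in E & F, forall A f, A \subset cluster t -> ~~ cuts A f}.
Proof.
elim: t => [x _|l IHl r IHr Ut].
  exists [:: Leaf x].
    split=> [//|f|f A]; rewrite inE => /eqP-> //.
    move=> C; rewrite inE => /eqP-> u v; rewrite !inE => /eqP-> /eqP->.
    exact: connect0.
  by move=> A f _; rewrite inE => /eqP-> sA; rewrite /cuts sA andbF.
have := Ut; rewrite /= cat_uniq => /and3P[Ul /hasPn dis Ur].
have [Fl [pl cl bl] satl] := IHl Ul; have [Fr [pr cr br] satr] := IHr Ur.
have rFl : refines l Fl by []. have rFr : refines r Fr by [].
have disj x : x \in cluster l -> x \in cluster r -> False.
  by rewrite !inE => lx /dis/negP.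
apply: (@refines_saturate _ (Fl ++ Fr)).
  split.
  - by rewrite map_cat flatten_cat perm_cat.
  - by move=> f; rewrite mem_cat => /orP[/cl|/cr].
  - move=> f A; rewrite mem_cat => /orP[Ff|Ff] EA sA.
      have sAl := subset_trans sA (refines_sub rFl Ff).
      by rewrite /= sAl; apply: bl.
    have sAr := subset_trans sA (refines_sub rFr Ff).
    by rewrite lca_Node_r ?edge_neq0 //; apply: br.
(* An edge cutting a tree of [Fl] is not inside [l], since [Fl] is saturated, nor inside [r], since
   it meets [l]; so [lca] stops at the node. The case of [Fr] is symmetric. *)
move=> A f EA; rewrite mem_cat => Ff _ cutAf.
have /andP[/pred0Pn[x /andP[/= Ax fx]] _] := cutAf.
case/orP: Ff => Ff.
  rewrite ifN; last by apply: contraL cutAf; apply: satl.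
  rewrite ifN //; apply/negP => /subsetP/(_ x Ax).
  by apply: disj; apply: subsetP (refines_sub rFl Ff) _ fx.
rewrite ifN; last first.
  apply/negP => /subsetP/(_ x Ax) lx; apply: disj lx _.
  by apply: subsetP (refines_sub rFr Ff) _ fx.
by rewrite ifN //; apply: contraL cutAf; apply: satr.
Qed.

(** * A single tree at the root *)

Lemma connected_closed (S : {set V}) x :
    graph_connected E -> x \in S ->
    (forall u v, u \in S -> [set u; v] \in E -> v \in S) ->
  S = setT.
Proof.
move=> conn Sx closedS; apply/setP=> y; rewrite inE.
case/connectP: (conn x y) => p ep ->.
by elim: p x Sx ep => //= z p IHp x Sx /andP[/(closedS x z Sx)/IHp].
Qed.

Lemma connected_refinement (H : hierarchy V) : graph_connected E ->
  exists T : hierarchy V, refines H [:: htree T].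
Proof.
case: H => t /= pt conn.
have Ut : uniq (leaves t) by rewrite (perm_uniq pt) enum_uniq.
have tT x : x \in cluster t by rewrite inE (perm_mem pt) mem_enum.
have [F rF satF] := component_forest Ut; have [pF _ _] := rF.
case: F rF satF pF => [|f F] rF satF pF.
  by move: pF (leaves_neq_nil t); rewrite perm_sym => /perm_nilP->.
have [x fx] : exists x, x \in cluster f.
  have := leaves_neq_nil f; case Df: (leaves f) => [//|x s] _.
  by exists x; rewrite inE Df mem_head.
(* Every edge lies inside the root cluster, so saturation makes [cluster f] closed under
   adjacency. *)
have fT : cluster f = setT.
  apply: connected_closed conn fx _ => u v fu Euv.
  have suv : [set u; v] \subset cluster t by apply/subsetP.
  have := satF _ f Euv (mem_head _ _) suv.
  rewrite /cuts negb_and !negbK => /orP[/pred0P/(_ u)|/subsetP->//].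
    by rewrite /= fu set21.
  exact: set22.
have := Ut; rewrite -(perm_uniq pF) /= cat_uniq => /and3P[_ /hasPn dis _].
case: F => [|g F] in rF satF pF dis *.
  have pf : perm_eq (leaves f) (enum V).
    by apply: perm_trans pt; move: pF; rewrite /= cats0.
  by exists (Hierarchy pf).
(* A second tree would have a leaf [y] that already occurs in [f], against distinctness of the
   leaves. *)
have := leaves_neq_nil g; case Dg: (leaves g) => [//|y s] _.
have /negP[] : y \notin leaves f by apply: dis; rewrite /= Dg mem_head.
by have := in_setT y; rewrite -fT inE.
Qed.

End Forests.

Theorem lemma3 (R : realFieldType) (V : finType)
  (E : {set {set V}}) (w : {set V} -> R)
  (hE : forall A : {set V}, A \in E -> #|A| = 2%N)
  (hconn : graph_connected E)
  (hn : (2 <= #|V|)%N)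
  (hw : forall A : {set V}, A \in E -> 0 < w A)
  (H : hierarchy V) :
  exists T : hierarchy V,
    [/\ forall C : {set V}, C \in clusters T -> induces_connected E C,
        forall x y : V, [set x; y] \in E ->
          (#|lca_cluster T [set x; y]| <= #|lca_cluster H [set x; y]|)%N,
        cost_D_minus E w T <= cost_D_minus E w H
      & cost_D E w T <= cost_D E w H].
Proof.
have [T [_ cT bT]] := connected_refinement hE H hconn; exists T.
have leT A : A \in E -> (#|lca_cluster T A| <= #|lca_cluster H A|)%N.
  (* The bound needs the edge to lie inside the single tree, whose cluster is all of [V]. *)
  move=> EA; apply: bT => //; first exact: mem_head.
  apply/subsetP => x _; case: T {cT} => t pt.
  by rewrite inE (perm_mem pt) mem_enum.
have w_ge0 A : A \in E -> 0 <= w A by move/hw; rewrite lt0r => /andP[].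
split.
- by move=> C; apply: cT; apply: mem_head.
- by move=> x y; apply: leT.
- apply: ler_sum => A EA; apply: ler_wpM2l; first exact: w_ge0.
  by rewrite lerD2r ler_nat leT.
- apply: ler_sum => A EA; apply: ler_wpM2l; first exact: w_ge0.
  by rewrite ler_nat leT.
Qed.
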